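(* Let $\mathcal{H}\in\mathbb{C}^{[n_1,\ldots,n_m]}$ be $\mathbb{C}$-positive definite. Then there exist integers $k_1,\ldots,k_m\ge 0$ such that $\mathcal{H}\in\Omega_{\mathbb{C}}^{k_1\ldots k_m}$. Consequently, $$\operatorname{int}\big(\mathscr{P}_{\mathbb{C}}^{[n_1,\ldots,n_m]}\big)\subseteq\bigcup_{k_1,\ldots,k_m\ge 0}\Omega_{\mathbb{C}}^{k_1\ldots k_m}\subseteq\mathscr{P}_{\mathbb{C}}^{[n_1,\ldots,n_m]}.$$
   Context: $\mathbb{C}^{[n_1,\ldots,n_m]}$ is the real vector space of tensors $\mathcal{H}\in\mathbb{C}^{n_1\times\cdots\times n_m\times n_1\times\cdots\times n_m}$ with $\mathcal{H}_{i_1\ldots i_m j_1\ldots j_m}=\overline{\mathcal{H}_{j_1\ldots j_m i_1\ldots i_m}}$. For $x=(x_1,\ldots,x_m)$, $x_i\in\mathbb{C}^{n_i}$, let $\mathcal{H}(x,\overline{x}):=\sum\mathcal{H}_{i_1\ldots i_mj_1\ldots j_m}\overline{(x_1)_{i_1}\cdots(x_m)_{i_m}}(x_1)_{j_1}\cdots(x_m)_{j_m}$ (the inner product of $\mathcal{H}$ with $x_1\otimes\cdots\otimes x_m\otimes\overline{x_1}\otimes\cdots\otimes\overline{x_m}$, where $\langle\mathcal{A},\mathcal{B}\rangle=\sum\mathcal{A}_{\cdot}\overline{\mathcal{B}_{\cdot}}$), a real-valued conjugate polynomial. $\mathcal{H}$ is $\mathbb{C}$-psd if $\mathcal{H}(x,\overline{x})\ge0$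 for all $x_i\in\mathbb{C}^{n_i}$, and $\mathbb{C}$-positive definite if $\mathcal{H}(x,\overline{x})>0$ for all nonzero $x_i\in\mathbb{C}^{n_i}$. $\mathscr{P}_{\mathbb{C}}^{[n_1,\ldots,n_m]}$ is the cone of $\mathbb{C}$-psd tensors. $\Sigma[x]$ denotes the set of Hermitian sums of squares, i.e. conjugate polynomials of the form $|p_1(x)|^2+\cdots+|p_k(x)|^2$ with $p_i$ complex polynomials in $x$ (not involving $\overline{x}$). With $|x_i|:=\sqrt{x_i^*x_i}$, $\Omega_{\mathbb{C}}^{k_1\ldots k_m}:=\{\mathcal{H}\in\mathbb{C}^{[n_1,\ldots,n_m]}:|x_1|^{2k_1}\cdots|x_m|^{2k_m}\mathcal{H}(x,\overline{x})\in\Sigma[x]\}$. $\operatorname{int}$ denotes interior in the Euclidean topology. *)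

(* Defs.v *)
From HB Require Import structures.
From mathcomp Require Import all_boot all_order all_algebra.
From mathcomp Require Import reals.
From mathcomp Require Import complex.
From mathcomp Require Import mpoly.
Set Implicit Arguments. Unset Strict Implicit. Unset Printing Implicit Defensive.
Import Order.TTheory GRing.Theory Num.Theory.
Local Open Scope ring_scope.
Local Open Scope complex_scope.

Section HermTensors.
Variables (R : realType) (m : nat) (n : 'I_m -> nat).

Definition idx := {dffun forall k : 'I_m, 'I_(n k)}.

(* tensors in C^{n_1 x ... x n_m x n_1 x ... x n_m}: H I J = H_{i_1..i_m j_1..j_m} *)
Definition tensor := idx -> idx -> R[i].

Definition hermitian (H : tensor) : Prop := forall I J : idx, H I J = (H J I)^*.

Definition cvecs := forall k : 'I_m, 'cV[R[i]]_(n k).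

Definition monom (x : cvecs) (I : idx) : R[i] := \prod_(k < m) x k (I k) ord0.

Definition Heval (H : tensor) (x : cvecs) : R[i] :=
  \sum_(I : idx) \sum_(J : idx) H I J * (monom x I)^* * monom x J.

Definition sqnorm (k : 'I_m) (x : cvecs) : R[i] := \sum_(j < n k) `|x k j ord0| ^+ 2.

Definition Cpsd (H : tensor) : Prop := hermitian H /\ forall x : cvecs, 0 <= Heval H x.

Definition Cpd (H : tensor) : Prop :=
  hermitian H /\ forall x : cvecs, (forall k, x k != 0) -> 0 < Heval H x.

(* the complex variables (x_k)_j, enumerated as 'I_N with N = n_1 + ... + n_m *)
Definition var := {k : 'I_m & 'I_(n k)}.
Definition nvars := #|{: var}|.
Definition assign (x : cvecs) : 'I_nvars -> R[i] :=
  fun a => let v := enum_val a in x (tag v) (tagged v) ord0.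

(* Hermitian sums of squares Sigma[x]: functions |p_1(x)|^2 + ... + |p_r(x)|^2
   with p_i complex polynomials in x (not involving conj x) *)
Definition HSOS (f : cvecs -> R[i]) : Prop :=
  exists s : seq {mpoly R[i][nvars]},
    forall x : cvecs, f x = \sum_(p <- s) `|p.@[assign x]| ^+ 2.

Definition Omega (kk : 'I_m -> nat) (H : tensor) : Prop :=
  hermitian H /\
  HSOS (fun x => (\prod_(k < m) sqnorm k x ^+ kk k) * Heval H x).

Definition dist2 (H H' : tensor) : R[i] :=
  \sum_(I : idx) \sum_(J : idx) `|H I J - H' I J| ^+ 2.

Definition int_Cpsd (H : tensor) : Prop :=
  hermitian H /\
  exists e : R, 0 < e /\
    forall H' : tensor, hermitian H' -> dist2 H H' < (e ^+ 2)%:C -> Cpsd H'.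

End HermTensors.

(* Main.v *)
Require Import Defs.
From HB Require Import structures.
From mathcomp Require Import all_boot all_order all_algebra.
From mathcomp Require Import reals.
From mathcomp Require Import complex.
From mathcomp Require Import ring lra zify.
From mathcomp Require boolp classical_sets filter topology normedtype derive.
Set Implicit Arguments. Unset Strict Implicit. Unset Printing Implicit Defensive.
Import Order.TTheory GRing.Theory Num.Theory.
Local Open Scope ring_scope.

(** Put [z_I = \prod_k x_k(I_k)], so that [H(x, conj x)] is a Hermitian form in
    [z] evaluated at a product vector, and [|z|^2 = \prod_k |x_k|^2].  The numbers
    [y_a = |z_I + i^c z_J|^2], [a = (I, J, c)], sum up to a multiple of [|z|^2], and
    by polarization the entries of [z z^*] are linear in [y].  Hence [H] is a
    linear form [f] in the nonnegative variables [y], but [f] need not be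
    positive off the image of [z |-> y].  The points of the simplex coming from
    some [x] are cut out by polynomial equations: the reconstructed matrix [Y] is
    Hermitian, has the right trace, and satisfies
    [Y_IJ Y_KL = Y_I'J Y_K'L] whenever [I', K'] arise from [I, K] by exchanging
    one coordinate.  Let [g] be the sum of the squared moduli of these relations.
    By compactness [f + C g] is positive on the simplex for some [C], so by
    Polya's theorem [(\sum_a y_a)^N (f + C g)] has nonnegative coefficients
    for large [N].  Substituting [y], [g] vanishes and every monomial in [y]
    becomes the squared modulus of a polynomial in [x]. *)

(** A union bound: of the [M ^ D] maps from [D] points to [M] points at most a proportion
    [D ^ 2 / M] is not injective, since one more point hits one of at most [D] earlier values with
    probability at most [D / M]. *)
Lemma expn_le_ffact (M D : nat) : (M * M ^ D <= M * M ^_ D + D ^ 2 * M ^ D)%N.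
Proof.
elim: D => [|D IH]; first by rewrite ffactn0 expn0; lia.
have le_ff : (M ^_ D <= M ^ D)%N.
  elim: D {IH} => // D IH; rewrite ffactnSr expnSr; apply: leq_mul => //; exact: leq_subr.
rewrite ffactnSr expnSr.
have h1 : (M <= (M - D) + D)%N by lia.
have h2 := leq_mul IH (leqnn M).
have h3 := leq_mul (leqnn (M * M ^_ D)) h1.
have h4 := leq_mul (leqnn (M * D)) le_ff.
have e : ((D.+1) ^ 2 = D ^ 2 + D.*2 + 1)%N by lia.
rewrite e; nia.
Qed.

(** * Forms with coefficients on words *)

Section Words.
Variables (R : comPzRingType) (A : finType).

(** Coefficients sit on words rather than on monomials, with [P] as the set of positions: products
    become concatenations over [P + Q], and no multinomial coefficients occur. *)
Definition weval (P : finType) (c : {ffun P -> A} -> R) (p : A -> R) : R :=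
  \sum_w c w * \prod_i p (w i).

Definition pullback (P Q : finType) (s : {ffun P -> Q}) (W : {ffun Q -> A}) :
  {ffun P -> A} := [ffun i => W (s i)].

(** The words [W] with subword [w] along [s] are prescribed on the image of [s] and free elsewhere,
    so the sum factors over positions; [F q] is the set of letters allowed at [q]. *)
Lemma sum_fiber_pullback (P Q : finType) (s : {ffun P -> Q}) (y : A -> R)
    (w : {ffun P -> A}) : injective s ->
  \sum_(W | pullback s W == w) \prod_q y (W q) =
  (\sum_a y a) ^+ (#|Q| - #|P|) * \prod_i y (w i).
Proof.
move=> injs.
pose F (q : Q) : pred A :=
  fun a => [forall i, (s i == q) ==> (a == w i)].
rewrite (eq_bigl (fun W => W \in family F)); last first.
  move=> W; apply/eqP/familyP => [Ww q | FW].
    apply/forallP => i; apply/implyP => /eqP <-.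
    by rewrite -Ww ffunE eqxx.
  apply/ffunP => i; rewrite ffunE.
  by have /forallP/(_ i) := FW (s i); rewrite eqxx => /eqP.
rewrite -(bigA_distr_big_dep F (fun _ => y)).
rewrite (bigID (mem (codom s))) /= mulrC; congr (_ * _).
  rewrite (eq_bigr (fun _ => \sum_a y a)) => [|q qs].
    rewrite prodr_const; congr (_ ^+ _).
    rewrite -(card_codom injs) -[in RHS](cardC (mem (codom s))) addKn.
    exact: eq_card.
  apply: eq_bigl => a; apply/forallP => i; apply/implyP => /eqP siq.
  by rewrite -siq codom_f in qs.
rewrite -big_uniq /=; last by rewrite map_inj_uniq ?enum_uniq.
rewrite big_map big_enum /=; apply: eq_bigr => i _.
rewrite (big_pred1 (w i)) // => a; apply/forallP/eqP => [/(_ i)|-> j].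
  by rewrite eqxx => /eqP.
by apply/implyP => /eqP/injs->.
Qed.

(** Each injective [s] yields another word representation of one and the same product, so these can
    be averaged over [s]. *)
Lemma sum_pullback (P Q : finType) (s : {ffun P -> Q}) (c : {ffun P -> A} -> R)
    (y : A -> R) : injective s ->
  \sum_W c (pullback s W) * \prod_q y (W q) =
  (\sum_a y a) ^+ (#|Q| - #|P|) * weval c y.
Proof.
move=> injs; rewrite (partition_big (pullback s) predT) //= mulr_sumr.
apply: eq_bigr => w _; rewrite mulrCA -(sum_fiber_pullback y w injs) mulr_sumr.
by apply: eq_bigr => W /eqP->.
Qed.

(* Drawing the letters of [c] from [W] with replacement evaluates [c] at the
   letter counts of [W]. *)
Lemma sum_all_pullback (P Q : finType) (c : {ffun P -> A} -> R)
    (W : {ffun Q -> A}) :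
  \sum_(s : {ffun P -> Q}) c (pullback s W) =
  weval c (fun a => #|[pred q | W q == a]|%:R).
Proof.
rewrite (partition_big (fun s => pullback s W) predT) //=.
apply: eq_bigr => w _.
transitivity (\sum_(s | pullback s W == w) c w * 1).
  by apply: eq_bigr => s /eqP->; rewrite mulr1.
rewrite -mulr_sumr; congr (_ * _).
under [RHS]eq_bigr do rewrite -sum1_card natr_sum.
rewrite bigA_distr_big_dep; apply: eq_big => [s|s _]; last by rewrite big1.
apply/eqP/familyP => [<- i|sW]; first by rewrite inE /= ffunE.
by apply/ffunP => i; rewrite ffunE; have := sW i; rewrite inE => /eqP.
Qed.

Lemma wevalZ (P : finType) (c : {ffun P -> A} -> R) (t : R) (y : A -> R) :
  weval c (fun a => t * y a) = t ^+ #|P| * weval c y.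
Proof.
rewrite /weval mulr_sumr; apply: eq_bigr => w _.
by rewrite big_split /= prodr_const mulrCA.
Qed.

Lemma weval_const (P : finType) (k : R) (y : A -> R) :
  weval (fun _ : {ffun P -> A} => k) y = k * (\sum_a y a) ^+ #|P|.
Proof. by rewrite /weval -mulr_sumr -(bigA_distr_bigA (fun _ => y)) prodr_const. Qed.

Lemma weval_prod (P Q : finType) (c : {ffun P -> A} -> R)
    (d : {ffun Q -> A} -> R) (y : A -> R) :
  weval (fun w : {ffun P + Q -> A} =>
    c [ffun i => w (inl i)] * d [ffun i => w (inr i)]) y =
  weval c y * weval d y.
Proof.
rewrite /weval mulr_suml; under [RHS]eq_bigr do rewrite mulr_sumr.
rewrite pair_big /=.
rewrite (reindex (fun u : {ffun P -> A} * {ffun Q -> A} =>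
   [ffun i => match i with inl i => u.1 i | inr i => u.2 i end])) /=; last first.
  exists (fun w => ([ffun i => w (inl i)], [ffun i => w (inr i)])) => [[u v] _|w _].
    by congr pair; apply/ffunP => i; rewrite !ffunE.
  by apply/ffunP => -[] i; rewrite !ffunE.
apply: eq_bigr => -[u v] _ /=; rewrite mulrACA; congr (_ * _ * _).
- by congr c; apply/ffunP => i; rewrite !ffunE.
- by congr d; apply/ffunP => i; rewrite !ffunE.
- by rewrite big_sumType /=; congr (_ * _); apply: eq_bigr => i _; rewrite ffunE.
Qed.

(* Only the hyperplane [\sum_a p a = 1] matters, so that polynomials of different
   degrees can be homogenized for free. *)
Definition wpoly (f : (A -> R) -> R) : Prop :=
  exists (P : finType) (c : {ffun P -> A} -> R),
    forall p, \sum_a p a = 1 -> f p = weval c p.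

Lemma wpoly_ext f g : (forall p, f p = g p) -> wpoly f -> wpoly g.
Proof. by move=> fg [P [c fc]]; exists P, c => p sp; rewrite -fg fc. Qed.

Lemma wpolyM f g : wpoly f -> wpoly g -> wpoly (fun p => f p * g p).
Proof.
move=> [P [c fc]] [Q [d gd]]; exists (P + Q)%type; eexists => p sp.
by rewrite fc // gd // -weval_prod.
Qed.

Lemma wpoly_const k : wpoly (fun _ => k).
Proof.
by exists void, (fun _ => k) => p sp; rewrite weval_const sp expr1n mulr1.
Qed.

Lemma wpolyD f g : wpoly f -> wpoly g -> wpoly (fun p => f p + g p).
Proof.
move=> [P [c fc]] [Q [d gd]]; exists (P + Q)%type.
(* Padding with the constant 1, a power of [\sum_a p a], brings both summands to degree
   [#|P| + #|Q|]. *)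
exists (fun w : {ffun P + Q -> A} =>
  c [ffun i => w (inl i)] * 1 + 1 * d [ffun i => w (inr i)]) => p sp.
rewrite fc // gd //.
have e (T : finType) : weval (fun _ : {ffun T -> A} => 1) p = 1.
  by rewrite weval_const sp expr1n mulr1.
transitivity (weval c p * weval (fun _ : {ffun Q -> A} => 1) p +
              weval (fun _ : {ffun P -> A} => 1) p * weval d p).
  by rewrite !e mulr1 mul1r.
rewrite -!weval_prod /weval -big_split /=.
by apply: eq_bigr => w _; rewrite mulrDl.
Qed.

Lemma wpoly_coord a : wpoly (fun p => p a).
Proof.
exists unit, (fun w => (w tt == a)%:R) => p sp.
rewrite /weval (bigD1 [ffun _ => a]) //= ffunE eqxx mul1r [X in _ + X]big1 => [|w wa].
  by rewrite addr0 (bigD1 tt) //= ffunE big1 ?mulr1 // => -[].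
case: eqP => [e|_]; last by rewrite mul0r.
by case/eqP: wa; apply/ffunP => -[]; rewrite ffunE.
Qed.

Lemma wpolyN f : wpoly f -> wpoly (fun p => - f p).
Proof.
move=> Pf; apply: (wpoly_ext (f := fun p => -1 * f p)) => [p|]; first exact: mulN1r.
by apply: wpolyM => //; apply: wpoly_const.
Qed.

Lemma wpoly_sum (I : Type) (r : seq I) (f : I -> (A -> R) -> R) :
  (forall i, wpoly (f i)) -> wpoly (fun p => \sum_(i <- r) f i p).
Proof.
move=> Pf; elim: r => [|i r IH].
  by apply: (wpoly_ext (f := fun _ => 0)) (wpoly_const 0) => p; rewrite big_nil.
apply: (wpoly_ext (f := fun p => f i p + \sum_(j <- r) f j p)) => [p|].
  by rewrite big_cons.
exact: wpolyD.
Qed.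

End Words.

(** * Polya's theorem *)

Section Polya.
Variables (R : realType) (A : finType).

Definition simplex (p : A -> R) : Prop := (forall a, 0 <= p a) /\ \sum_a p a = 1.

(* Drawing without replacement differs from drawing with replacement only on
   the non-injective [s], whose proportion is [O(1/#|Q|)]. *)
Lemma sum_inj_pullback_ge (P Q : finType) (c : {ffun P -> A} -> R) (d : R)
    (W : {ffun Q -> A}) :
  (0 < #|Q|)%N -> (forall p, simplex p -> d <= weval c p) ->
  d * (#|Q| ^ #|P|)%:R
    - (\sum_w `|c w|) * (#|Q| ^ #|P| - #|Q| ^_ #|P|)%:R <=
  \sum_(s : {ffun P -> Q} | injectiveb s) c (pullback s W).
Proof.
move=> Q0 dc; set B := \sum_w _.
have Qn0 : #|Q|%:R != 0 :> R by rewrite pnatr_eq0 -lt0n.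
(* The letter frequencies of [W]; by homogeneity the letter counts only add the factor
   [#|Q| ^ #|P|]. *)
pose p a : R := #|Q|%:R^-1 * #|[pred q | W q == a]|%:R.
have sp : simplex p.
  split=> [a|]; first by rewrite mulr_ge0 ?invr_ge0 ?ler0n.
  rewrite -mulr_sumr -natr_sum; apply: (mulfI Qn0); rewrite mulVKf // mulr1.
  congr (_%:R); rewrite -sum1_card (partition_big W predT) //=.
  by apply: eq_bigr => a _; rewrite -sum1_card.
have all_ge : d * (#|Q| ^ #|P|)%:R <= \sum_(s : {ffun P -> Q}) c (pullback s W).
  rewrite sum_all_pullback.
  have -> : weval c (fun a => #|[pred q | W q == a]|%:R) =
            #|Q|%:R ^+ #|P| * weval c p.
    rewrite -wevalZ /weval; apply: eq_bigr => w _; congr (_ * _).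
    by apply: eq_bigr => i _; rewrite /p mulVKf.
  by rewrite mulrC natrX ler_wpM2l ?exprn_ge0 ?ler0n //; apply: dc.
have cB w : c w <= B.
  rewrite (le_trans (ler_norm _)) // /B (bigD1 w) //= lerDl.
  by apply: sumr_ge0.
have nonB : \sum_(s : {ffun P -> Q} | ~~ injectiveb s) c (pullback s W) <=
            B * (#|Q| ^ #|P| - #|Q| ^_ #|P|)%:R.
  apply: (le_trans (ler_sum _ (fun s _ => cB (pullback s W)))).
  rewrite sumr_const -[leLHS]mulr_natr le_eqVlt; apply/orP; left; apply/eqP.
  congr (_ * _%:R); rewrite -card_ffun -card_inj_ffuns cardsE.
  rewrite -[X in (X - _)%N](cardC (fun s : {ffun P -> Q} => injectiveb s)) addKn.
  exact: eq_card.
rewrite lerBlDr; apply: le_trans all_ge _.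
by rewrite (bigID (fun s : {ffun P -> Q} => injectiveb s)) /= lerD2l.
Qed.

(* Polya's theorem; the coefficient of a word [W] is the average of [c] over the
   subwords of [W]. *)
Lemma polya (P : finType) (c : {ffun P -> A} -> R) (d : R) :
  0 < d -> (forall p, simplex p -> d <= weval c p) ->
  exists (M : nat) (b : {ffun 'I_M -> A} -> R),
    [/\ (0 < M)%N, (#|P| <= M)%N, forall W, 0 <= b W &
      forall y : A -> R, weval b y = (\sum_a y a) ^+ (M - #|P|) * weval c y].
Proof.
move=> d0 dc; set D := #|P|; pose B := \sum_w `|c w|.
have B0 : 0 <= B by apply: sumr_ge0.
(* With [B * D ^ 2 <= d * M], [expn_le_ffact] bounds the error from non-injective draws by
   [d * M ^ D]. *)
pose M := (D + (Num.truncn (B * (D ^ 2)%:R / d)).+1)%N.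
have M0 : (0 < M)%N by rewrite /M addnS.
have DM : (D <= M)%N by exact: leq_addr.
have BM : B * (D ^ 2)%:R <= d * M%:R.
  rewrite -ler_pdivrMl // mulrC ltW // (lt_le_trans (truncnS_gt _)) //.
  by rewrite ler_nat leq_addl.
have inj0 : 0 < (M ^_ D)%:R :> R by rewrite ltr0n ffact_gt0.
pose b (W : {ffun 'I_M -> A}) : R := (M ^_ D)%:R^-1 *
  \sum_(s : {ffun P -> 'I_M} | injectiveb s) c (pullback s W).
exists M, b; split=> // [W|y].
  rewrite mulr_ge0 ?invr_ge0 ?(ltW inj0) //.
  have := @sum_inj_pullback_ge P 'I_M c d W; rewrite card_ord => /(_ M0 dc).
  apply: le_trans; rewrite -/D -/B.
  rewrite -(pmulr_rge0 (x := M%:R)) ?ltr0n // mulrBr subr_ge0.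
  have := expn_le_ffact M D; rewrite -leq_subLR -mulnBr -(ler_nat R) !natrM => h.
  rewrite mulrCA; apply: le_trans (ler_wpM2l B0 h) _.
  by rewrite mulrA [leRHS]mulrA [_ * d]mulrC ler_wpM2r ?ler0n // -natrM.
rewrite /weval /b.
under eq_bigr do rewrite -mulrA mulr_suml.
rewrite -mulr_sumr exchange_big /=.
transitivity ((M ^_ D)%:R^-1 * \sum_(s : {ffun P -> 'I_M} | injectiveb s)
                (\sum_a y a) ^+ (M - D) * weval c y).
  congr (_ * _); apply: eq_bigr => s /injectiveP injs.
  by rewrite sum_pullback // card_ord.
rewrite sumr_const -[X in _ * X = _]mulr_natl.
have -> : #|[pred s : {ffun P -> 'I_M} | injectiveb s]| = (M ^_ D)%N.
  by rewrite -[in RHS](card_ord M) -card_inj_ffuns cardsE; apply: eq_card.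
by rewrite mulrA mulVf ?mul1r // gt_eqF.
Qed.

End Polya.

(** * Compactness and the weight of the penalty *)

Module Compactness.
Import boolp classical_sets filter topology function_spaces normedtype.
Import numFieldNormedType.Exports.
Local Open Scope classical_set_scope.

Section Penalty.
Variables (R : realType) (A : finType).

Let pt (v : 'rV[R]_#|A|) : A -> R := fun a => v ord0 (enum_rank a).
Let K : set 'rV[R]_#|A| := [set v | simplex (pt v)].

Let pt_continuous a : continuous (fun v => pt v a).
Proof. exact: coord_continuous. Qed.

Let weval_continuous (P : finType) (c : {ffun P -> A} -> R) :
  continuous (fun v => weval c (pt v)).
Proof.
apply: continuous_big => [|w _]; first exact: add_continuous.
have cw : continuous (fun v => \prod_i pt v (w i)).
  by apply: continuous_big => [|i _]; [exact: mul_continuous | exact: pt_continuous].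
by move=> v; apply: (@continuousM _ _ (fun=> c w)); [exact: cst_continuous | exact: cw].
Qed.

Let K_compact : compact K.
Proof.
pose B := [set v : 'rV[R]_#|A| | forall i, (`[0, 1] : set R) (v ord0 i)].
apply: (subclosed_compact (B := B)).
- have -> : K = (\bigcap_(a in setT) (fun v => pt v a) @^-1` [set x | 0 <= x])
       `&` (fun v => \sum_a pt v a) @^-1` [set 1].
    apply/seteqP; split=> v; first by move=> [h1 h2]; split=> // a _; apply: h1.
    by move=> [h1 h2]; split=> // a; apply: h1.
  apply: closedI.
    apply: closed_bigI => a _; apply: closed_comp; last exact: closed_ge.
    by move=> v _; apply: pt_continuous.
  apply: closed_comp; last exact: closed_eq.
  move=> v _; apply: continuous_big => [|a _]; first exact: add_continuous.
  exact: pt_continuous.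
- apply: (rV_compact (A := fun _ => `[0, 1] : set R)) => i.
  exact: segment_compact.
- move=> v [v0 v1] i /=; rewrite in_itv /=.
  have e : v ord0 i = pt v (enum_val i) by rewrite /pt enum_valK.
  rewrite e v0 -v1 (bigD1 (enum_val i)) //= lerDl.
  by apply: sumr_ge0 => a _; apply: v0.
Qed.

(** On the compact set where [f <= 0], [g] is positive and so bounded below, and a large [C]
    outweighs the minimum of [f]; elsewhere [f] is positive already. The bound [d] is then the
    minimum of [f + C * g]. *)
Lemma exists_penalty_weight (P Q : finType) (f : {ffun P -> A} -> R) (g : {ffun Q -> A} -> R) :
  (forall p, simplex p -> 0 <= weval g p) ->
  (forall p, simplex p -> weval g p = 0 -> 0 < weval f p) ->
  exists C d : R, 0 < d /\
    forall p, simplex p -> d <= weval f p + C * weval g p.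
Proof.
move=> g0 fg.
have toK p : simplex p -> exists2 v, K v & pt v = p.
  move=> sp; exists (\row_i p (enum_val i)).
    by move: sp; rewrite /K /=; congr simplex; apply/funext => a;
       rewrite /pt mxE enum_rankK.
  by apply/funext => a; rewrite /pt mxE enum_rankK.
have [Kn|K0] := pselect (K !=set0); last first.
  exists 0, 1; split=> // p /toK [v Kv _]; case: K0; by exists v.
have minK (h : 'rV[R]_#|A| -> R) (L : set 'rV[R]_#|A|) : L !=set0 ->
    compact L -> continuous h -> exists2 v, L v & forall u, L u -> h v <= h u.
  move=> L0 cL ch; have [|v] := derive.EVT_min_rV L0 cL (f := h).
    exact: continuous_subspaceT.
  rewrite inE => Lv vm; exists v => // u Lu; apply: vm; by rewrite inE.
suff [C Cpos] : exists C, forall v, K v -> 0 < weval f (pt v) + C * weval g (pt v).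
  have [|v Kv vm] := minK (fun v => weval f (pt v) + C * weval g (pt v)) K Kn K_compact.
    move=> v; apply: (@continuousD _ _ _ (fun v => weval f (pt v))).
      exact: weval_continuous.
    apply: (@continuousM _ _ (fun=> C)); first exact: cst_continuous.
    exact: weval_continuous.
  exists C, (weval f (pt v) + C * weval g (pt v)); split; first exact: Cpos.
  by move=> p /toK [u Ku <-]; apply: vm.
pose K' := K `&` (fun v => weval f (pt v)) @^-1` [set x | x <= 0].
have cK' : compact K'.
  apply: compact_closedI; first exact: K_compact.
  apply: closed_comp; last exact: closed_le.
  by move=> v _; apply: weval_continuous.
have [K'n|K'0] := pselect (K' !=set0); last first.
  exists 0 => v Kv; rewrite mul0r addr0 ltNge; apply/negP => fv.
  by apply: K'0; exists v.
have [v [Kv fv] vm] := minK _ _ K'n cK' (@weval_continuous _ g).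
have [w Kw wm] := minK _ _ Kn K_compact (@weval_continuous _ f).
have gv : 0 < weval g (pt v).
  rewrite lt_neqAle g0 // andbT; apply/eqP => gv.
  by have := fg _ Kv (esym gv); rewrite ltNge fv.
(* Here [f] is minimal on the simplex at [w], and [g] is minimal on [K'] at [v]; the added 1 makes
   the sum strictly positive. *)
exists ((`|weval f (pt w)| + 1) / weval g (pt v)) => u Ku.
have [fu|fu] := ltP 0 (weval f (pt u)).
  by rewrite ltr_wpDr // mulr_ge0 ?g0 // divr_ge0 ?addr_ge0 // ltW.
have gu : weval g (pt v) <= weval g (pt u) by apply: vm.
have fw := wm _ Ku.
have nf := ler_norm (- weval f (pt w)); rewrite normrN in nf.
have : `|weval f (pt w)| + 1 <=
       (`|weval f (pt w)| + 1) / weval g (pt v) * weval g (pt u).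
  rewrite -mulrA ler_peMr ?addr_ge0 // mulrC ler_pdivlMr // mul1r //.
lra.
Qed.

End Penalty.
End Compactness.

(** * Positivity on the zeros of a penalty *)

Section Positivstellensatz.
Variables (R : realType) (A : finType).

(** Polya's theorem is applied to [f + C * g], which reduces to [f] where [g] vanishes. The point
    [y] is rescaled because [f] and [g] agree with forms only on the hyperplane of sum 1. *)
Lemma wpoly_positivstellensatz (f g : (A -> R) -> R) :
  wpoly f -> wpoly g ->
  (forall p, simplex p -> 0 <= g p) ->
  (forall p, simplex p -> g p = 0 -> 0 < f p) ->
  exists (M : nat) (b : {ffun 'I_M -> A} -> R),
    [/\ (0 < M)%N, forall W, 0 <= b W &
      forall y : A -> R, 0 < \sum_a y a ->
        g (fun a => (\sum_a y a)^-1 * y a) = 0 ->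
        weval b y = (\sum_a y a) ^+ M * f (fun a => (\sum_a y a)^-1 * y a)].
Proof.
move=> Pf Pg g0 fg; have [P [cf fE]] := Pf; have [Q [cg gE]] := Pg.
have [||C [d [d0 dP]]] := @Compactness.exists_penalty_weight R A P Q cf cg.
- by move=> p sp; rewrite -gE ?g0 //; case: sp.
- by move=> p sp; rewrite -gE -?fE; [exact: fg| case: sp..].
have [U [c cE]] := wpolyD Pf (wpolyM (wpoly_const A C) Pg).
have [|M [b [M0 UM b0 bE]]] := @polya R A U c d d0.
  by move=> p sp; rewrite -cE ?fE ?gE ?dP //; case: sp.
exists M, b; split=> // y s0 gy.
set s := \sum_a y a in s0 gy *; have sn : s != 0 by rewrite gt_eqF.
have sp : \sum_a (s^-1 * y a) = 1 by rewrite -mulr_sumr mulVf.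
rewrite bE -/s -(subnK UM) addnK exprD -mulrA; congr (_ * _).
have -> : weval c y = s ^+ #|U| * weval c (fun a => s^-1 * y a).
  by rewrite wevalZ mulrA -exprMn mulfV // expr1n mul1r.
by rewrite -cE // gy mulr0 addr0.
Qed.

End Positivstellensatz.

(** * Rank-one matrices of product vectors *)

Section ProductRankOne.
Variables (R : realType) (m : nat) (n : 'I_m -> nat).
Local Notation C := R[i].
Local Notation T := (idx n).

(** Distributivity when the index type varies with [k]; tagging the indices reduces it to the law
    for one fixed type. *)
Lemma prod_sum_idx (F : forall k, 'I_(n k) -> C) :
  \prod_k \sum_j F k j = \sum_(I : T) \prod_k F k (I k).
Proof.
pose G k := [ffun j => F k j].
transitivity (\sum_(t : fprod (fun k => 'I_(n k))) \prod_(k in 'I_m) G k (t k)).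
  rewrite (big_fprod 1 +%R G) -(bigA_distr_big_dep
    (fun k => tagged_with (fun k => 'I_(n k)) k) (fun k => untag 0 (G k))).
  apply: eq_bigr => k _; rewrite (eq_bigr (G k)) => [|j _]; last by rewrite ffunE.
  exact: (big_tag (fun k => G k : _ -> _) k).
rewrite (reindex (@dffun_of_fprod _ (fun k => 'I_(n k)))) /=; last first.
  exists (@fprod_of_dffun _ _) => ? _; [exact: dffun_of_fprodK | exact: fprod_of_dffunK].
apply: eq_bigr => t _; apply: eq_bigr => k _; by rewrite !ffunE.
Qed.

Definition swap (k : 'I_m) (I K : T) : T :=
  [ffun j => if j == k then K j else I j].

(* [mix j I K] is reached from [I], [K] by [j] successive swaps. *)
Let mix (j : nat) (I K : T) : T := [ffun k : 'I_m => if (k < j)%N then K k else I k].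

Let mix0 I K : mix 0 I K = I.
Proof. by apply/ffunP => k; rewrite ffunE. Qed.

Let mixm I K : mix m I K = K.
Proof. by apply/ffunP => k; rewrite ffunE ltn_ord. Qed.

Let swap_mix (k : 'I_m) I K : swap k (mix k I K) (mix k K I) = mix k.+1 I K.
Proof.
apply/ffunP => j; rewrite !ffunE; case: eqP => [->|/eqP jk].
  by rewrite ltnn ltnSn.
by rewrite ltnS [in RHS]leq_eqVlt (negPf (jk : (j : nat) != k)).
Qed.

(** Exchanging all coordinates in turn gives [Y I J * Y K L = Y K J * Y I L], so [Y] is a multiple
    of [u u^*] for a normalized column [u] through a positive diagonal entry. The single exchanges,
    inherited by [u], then split [u] into a product over the coordinates. *)
Lemma product_rank_one (Y : T -> T -> C) :
  (forall I J, Y I J = (Y J I)^*) ->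
  0 < \sum_I Y I I ->
  (forall k I J K L, Y I J * Y K L = Y (swap k I K) J * Y (swap k K I) L) ->
  exists (x : cvecs R n) (r : C),
    [/\ 0 < r, forall k, x k != 0 & forall I J, Y I J = r * monom x I * (monom x J)^*].
Proof.
move=> Yh Ytr Ysw.
have Yreal I : Y I I = (complex.Re (Y I I))%:C%C.
  have := Yh I I; case: (Y I I) => a b /= [] /= /eqP.
  by rewrite -addr_eq0 -mulr2n mulrn_eq0 /= => /eqP ->.
have [I0 r0] : exists I0, 0 < Y I0 I0.
  apply/existsP; apply: contraLR Ytr => /existsPn Yle.
  rewrite (eq_bigr (fun I => (complex.Re (Y I I))%:C%C)) => [|I _]; last exact: Yreal.
  rewrite -rmorph_sum /= ltcR -leNgt; apply: sumr_le0 => I _.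
  by have := Yle I; rewrite Yreal ltcR -leNgt.
set r := Y I0 I0 in r0.
have rn0 : r != 0 by rewrite gt_eqF.
have full I J K L : Y I J * Y K L = Y K J * Y I L.
  have H j : (j <= m)%N -> Y I J * Y K L = Y (mix j I K) J * Y (mix j K I) L.
    elim: j => [|j IH] jm; first by rewrite !mix0.
    by rewrite IH 1?ltnW // (Ysw (Ordinal jm)) !(swap_mix (Ordinal jm)).
  by rewrite (H m) // !mixm.
pose u I := Y I I0 / r.
have u0 : u I0 = 1 by rewrite /u divff.
have usw k I K : u I * u K = u (swap k I K) * u (swap k K I).
  by rewrite /u mulrACA (Ysw k) mulrACA.
have YE K L : Y K L = r * u K * (u L)^*.
  apply: (mulfI rn0); rewrite (full I0 I0 K L) (Yh I0 L) /u.
  have rr : r^* = r by rewrite -Yh.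
  rewrite rmorphM fmorphV /= rr; field.
  done.
(* The factors are the restrictions of [u] to the coordinate lines through [I0]. *)
pose x : cvecs R n := fun k => \col_i u (finfun (dfwith I0 i)).
have xE k (I : T) : x k (I k) ord0 = u (swap k I0 I).
  rewrite mxE; congr u; apply/ffunP => j; rewrite !ffunE.
  case: dfwithP => [|j' kj']; first by rewrite eqxx.
  by rewrite eq_sym (negPf kj').
have uE I : u I = monom x I.
  (* As [u I0 = 1], exchanging coordinate [j] with [I0] splits off exactly one factor. *)
  have H j : (j <= m)%N -> u (mix j I0 I) = \prod_(k < m | (k < j)%N) x k (I k) ord0.
    elim: j => [|j IH] jm; first by rewrite mix0 u0 big1.
    pose k := Ordinal jm.
    have := usw k (mix j.+1 I0 I) I0; rewrite u0 mulr1 => ->.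
    have -> : swap k (mix j.+1 I0 I) I0 = mix j I0 I.
      apply/ffunP => i; rewrite !ffunE; case: eqP => [->|/eqP ik] /=.
        by rewrite ltnn.
      by rewrite ltnS [in LHS]leq_eqVlt (negPf (ik : (i : nat) != j)).
    have -> : swap k I0 (mix j.+1 I0 I) = swap k I0 I.
      by apply/ffunP => i; rewrite !ffunE; case: eqP => [->|//]; rewrite ltnSn.
    rewrite -xE IH 1?ltnW // [RHS](bigD1 k) /= ?ltnSn // mulrC; congr (_ * _).
    apply: eq_bigl => i; rewrite -(inj_eq val_inj) /= ltnS.
    by case: ltngtP.
  by rewrite -[I in LHS](mixm I0) H //; apply: eq_bigl => k; rewrite ltn_ord.
exists x, r; split=> // [k|I J]; last by rewrite -!uE.
(* Every [x k] has the entry 1 at [I0 k]. *)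
apply/eqP => /matrixP/(_ (I0 k) ord0); rewrite xE mxE.
have -> : swap k I0 I0 = I0 by apply/ffunP => j; rewrite !ffunE if_same.
by rewrite u0 => /eqP; rewrite oner_eq0.
Qed.

End ProductRankOne.

(** * Polarization and complex-valued polynomials *)

Section ComplexPolynomials.
Variable R : realType.
Local Notation C := R[i].
Local Notation Re := (@complex.Re R).
Local Notation Im := (@complex.Im R).

Lemma ReD (x y : C) : Re (x + y) = Re x + Re y. Proof. by case: x; case: y. Qed.
Lemma ImD (x y : C) : Im (x + y) = Im x + Im y. Proof. by case: x; case: y. Qed.
Lemma ReM (x y : C) : Re (x * y) = Re x * Re y - Im x * Im y.
Proof. by case: x; case: y. Qed.
Lemma ImM (x y : C) : Im (x * y) = Re x * Im y + Im x * Re y.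
Proof. by case: x; case: y. Qed.
Lemma ReJ (x : C) : Re x^* = Re x. Proof. by case: x. Qed.
Lemma ImJ (x : C) : Im x^* = - Im x. Proof. by case: x. Qed.

Definition sqmod (x : C) : R := Re x ^+ 2 + Im x ^+ 2.

Lemma sqmodE (x : C) : (sqmod x)%:C%C = `|x| ^+ 2.
Proof. exact: add_Re2_Im2. Qed.

Lemma sqmod_ge0 (x : C) : 0 <= sqmod x.
Proof. by rewrite addr_ge0 ?sqr_ge0. Qed.

Lemma sqmod_eq0 (x : C) : (sqmod x == 0) = (x == 0).
Proof. by rewrite paddr_eq0 ?sqr_ge0 // !sqrf_eq0 eq_complex. Qed.

Lemma sum_i_pow (F : C -> C) :
  \sum_(c < 4) F ('i%C ^+ c) = F 1 + F 'i%C + F (-1) + F (- 'i%C).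
Proof.
rewrite !big_ord_recl big_ord0 /= addr0 !addrA expr0 expr1 sqr_i.
by rewrite exprS sqr_i mulrN1.
Qed.

Definition complex_reim := (ReD, ImD, ReM, ImM, ReJ, ImJ).

Lemma polarization (z w : C) :
  4^-1 * \sum_(c < 4) 'i%C ^+ c * (sqmod (z + 'i%C ^+ c * w))%:C%C = z * w^*.
Proof.
rewrite (sum_i_pow (fun u => u * (sqmod (z + u * w))%:C%C)).
have n4 : 4%:R != 0 :> C by rewrite pnatr_eq0.
apply: (mulfI n4); rewrite mulVKf // -(rmorph_nat (real_complex R)).
apply/eqP; rewrite eq_complex /sqmod !complex_reim /=.
by case: z => a b; case: w => c d /=; apply/andP; split; apply/eqP; ring.
Qed.

Lemma parallelogram4 (z w : C) :
  \sum_(c < 4) sqmod (z + 'i%C ^+ c * w) = 4 * (sqmod z + sqmod w).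
Proof.
apply: complexI; rewrite rmorph_sum /=.
rewrite (sum_i_pow (fun u => (sqmod (z + u * w))%:C%C)) -!rmorphD /=.
congr _%:C%C; rewrite /sqmod !complex_reim /=.
by case: z => a b; case: w => c d /=; ring.
Qed.

Variable A : finType.

(** Real and imaginary parts are kept apart because Polya's theorem concerns real coefficients. *)
Definition cwpoly (h : (A -> R) -> C) : Prop :=
  wpoly (fun p => Re (h p)) /\ wpoly (fun p => Im (h p)).

Lemma cwpoly_const (k : C) : cwpoly (fun _ => k).
Proof. by split; apply: wpoly_const. Qed.

Lemma cwpoly_coord a : cwpoly (fun p => (p a)%:C%C).
Proof. by split; [apply: wpoly_coord | apply: wpoly_const]. Qed.

Lemma cwpolyD h1 h2 : cwpoly h1 -> cwpoly h2 -> cwpoly (fun p => h1 p + h2 p).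
Proof.
move=> [r1 i1] [r2 i2]; split.
  by apply: wpoly_ext (wpolyD r1 r2) => p; rewrite ReD.
by apply: wpoly_ext (wpolyD i1 i2) => p; rewrite ImD.
Qed.

Lemma cwpolyM h1 h2 : cwpoly h1 -> cwpoly h2 -> cwpoly (fun p => h1 p * h2 p).
Proof.
move=> [r1 i1] [r2 i2]; split.
  by apply: wpoly_ext (wpolyD (wpolyM r1 r2) (wpolyN (wpolyM i1 i2))) => p; rewrite ReM.
by apply: wpoly_ext (wpolyD (wpolyM r1 i2) (wpolyM i1 r2)) => p; rewrite ImM.
Qed.

Lemma cwpolyJ h : cwpoly h -> cwpoly (fun p => (h p)^*).
Proof.
move=> [r i]; split; first by apply: wpoly_ext r => p; rewrite ReJ.
by apply: wpoly_ext (wpolyN i) => p; rewrite ImJ.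
Qed.

Lemma cwpolyB h1 h2 : cwpoly h1 -> cwpoly h2 -> cwpoly (fun p => h1 p - h2 p).
Proof.
move=> P1 [r2 i2]; apply: cwpolyD => //; split.
  by apply: wpoly_ext (wpolyN r2) => p; case: (h2 p).
by apply: wpoly_ext (wpolyN i2) => p; case: (h2 p).
Qed.

Lemma cwpoly_sum (I : Type) (r : seq I) (h : I -> (A -> R) -> C) :
  (forall i, cwpoly (h i)) -> cwpoly (fun p => \sum_(i <- r) h i p).
Proof.
move=> Ph; split.
  apply: wpoly_ext (wpoly_sum r (fun i => (Ph i).1)) => p.
  by elim: r => [|i r IH]; rewrite ?big_nil // !big_cons IH ReD.
apply: wpoly_ext (wpoly_sum r (fun i => (Ph i).2)) => p.
by elim: r => [|i r IH]; rewrite ?big_nil // !big_cons IH ImD.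
Qed.

Lemma wpoly_sqmod h : cwpoly h -> wpoly (fun p => sqmod (h p)).
Proof.
move=> [r i]; apply: wpoly_ext (wpolyD (wpolyM r r) (wpolyM i i)) => p.
by rewrite -!expr2.
Qed.

End ComplexPolynomials.

From mathcomp Require Import mpoly.

(** * The reconstructed matrix and its penalty *)

Section GramPenalty.
Variables (R : realType) (m : nat) (n : 'I_m -> nat).
Local Notation C := R[i].
Local Notation T := (idx n).

Definition letter := (T * T * 'I_4)%type.

Definition energy (z : T -> C) (a : letter) : R :=
  sqmod (z a.1.1 + 'i%C ^+ a.2 * z a.1.2).

(** The polarization formula for [z z^*], extended linearly to arbitrary [p], where the matrix need
    be neither Hermitian nor of rank one. *)
Definition gram (p : letter -> R) (I J : T) : C :=
  4^-1 * \sum_(c < 4) 'i%C ^+ c * (p (I, J, c))%:C%C.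

(** The factor [8 * #|T|] is the ratio of total energy to trace, so the middle term fixes the trace
    that an energy vector in the simplex has; in particular it excludes the zero matrix. *)
Definition penalty (p : letter -> R) : R :=
  \sum_(u : T * T) sqmod (gram p u.1 u.2 - (gram p u.2 u.1)^*) +
  sqmod ((8 * #|{: T}|)%:R * \sum_I gram p I I - 1) +
  \sum_(u : 'I_m * (T * T) * (T * T))
    sqmod (gram p u.1.2.1 u.1.2.2 * gram p u.2.1 u.2.2 -
           gram p (swap u.1.1 u.1.2.1 u.2.1) u.1.2.2 *
           gram p (swap u.1.1 u.2.1 u.1.2.1) u.2.2).

Lemma gramZ (t : R) p I J :
  gram (fun a => t * p a) I J = t%:C%C * gram p I J.
Proof.
rewrite /gram mulrCA; congr (_ * _); rewrite mulr_sumr; apply: eq_bigr => c _.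
by rewrite rmorphM mulrCA.
Qed.

Lemma gram_energy z I J : gram (energy z) I J = z I * (z J)^*.
Proof. by rewrite -polarization. Qed.

Lemma cwpoly_gram I J : cwpoly (fun p => gram p I J).
Proof.
apply: cwpolyM; first exact: cwpoly_const.
apply: cwpoly_sum => c; apply: cwpolyM; first exact: cwpoly_const.
exact: cwpoly_coord.
Qed.

(** A pair [(I, J)] contributes [4 * (|z_I|^2 + |z_J|^2)], and each index fills [2 * #|T|] places
    among all pairs. *)
Lemma sum_energy z :
  \sum_a energy z a = (8 * #|{: T}|)%:R * \sum_I sqmod (z I).
Proof.
rewrite -(pair_big predT predT (fun u c => energy z (u, c))) /=.
under eq_bigr do rewrite /energy /= parallelogram4.
rewrite -mulr_sumr -(pair_big predT predT (fun I J => sqmod (z I) + sqmod (z J))) /=.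
under eq_bigr do rewrite big_split sumr_const /=.
rewrite big_split sumr_const /= sumrMnl natrM.
set S := \sum_I _; rewrite -[S *+ _]mulr_natl; ring.
Qed.

Lemma wpoly_penalty : wpoly penalty.
Proof.
apply: wpolyD; first apply: wpolyD.
- apply: wpoly_sum => u; apply/wpoly_sqmod/cwpolyB; first exact: cwpoly_gram.
  exact/cwpolyJ/cwpoly_gram.
- apply/wpoly_sqmod/cwpolyB; last exact: cwpoly_const.
  apply: cwpolyM; first exact: cwpoly_const.
  by apply: cwpoly_sum => I; apply: cwpoly_gram.
- apply: wpoly_sum => u; apply/wpoly_sqmod/cwpolyB; apply: cwpolyM; exact: cwpoly_gram.
Qed.

Lemma penalty_ge0 p : 0 <= penalty p.
Proof.
apply: addr_ge0; first apply: addr_ge0; last by apply: sumr_ge0 => u _; apply: sqmod_ge0.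
  by apply: sumr_ge0 => u _; apply: sqmod_ge0.
exact: sqmod_ge0.
Qed.

Lemma penalty_eq0 p : penalty p = 0 <->
  [/\ forall I J, gram p I J = (gram p J I)^*,
      (8 * #|{: T}|)%:R * \sum_I gram p I I = 1 &
      forall k I J K L, gram p I J * gram p K L =
        gram p (swap k I K) J * gram p (swap k K I) L].
Proof.
split=> [/eqP|[h1 h2 h3]]; last first.
  rewrite /penalty h2 subrr big1 ?big1 => [|[[k [I J]] [K L]] _|[I J] _] /=.
  - by rewrite /sqmod /= expr0n /= !addr0.
  - by rewrite -h3 subrr /sqmod /= expr0n addr0.
  - by rewrite -h1 subrr /sqmod /= expr0n addr0.
have sq0 (z : C) : sqmod z = 0 -> z = 0 by move/eqP; rewrite sqmod_eq0 => /eqP.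
have sum0 (I : finType) (h : I -> C) : 0 <= \sum_i sqmod (h i).
  by apply: sumr_ge0 => i _; apply: sqmod_ge0.
rewrite paddr_eq0 //; last by apply: addr_ge0 => //; apply: sqmod_ge0.
rewrite paddr_eq0 //; last exact: sqmod_ge0.
case/andP => /andP[/eqP h1 /eqP h2] /eqP h3; split.
- move=> I J; apply/eqP; rewrite -subr_eq0; apply/eqP/sq0.
  by apply: (psumr_eq0P _ h1 (i := (I, J))) => // u _; apply: sqmod_ge0.
- by apply/eqP; rewrite -subr_eq0; apply/eqP/sq0.
- move=> k I J K L; apply/eqP; rewrite -subr_eq0; apply/eqP/sq0.
  by apply: (psumr_eq0P _ h3 (i := (k, (I, J), (K, L)))) => // u _; apply: sqmod_ge0.
Qed.

Lemma monom_swap k (x : cvecs R n) I K :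
  monom x I * monom x K = monom x (swap k I K) * monom x (swap k K I).
Proof.
rewrite /monom -!big_split /=; apply: eq_bigr => j _; rewrite !ffunE.
by case: eqP => // _; rewrite mulrC.
Qed.

Lemma sum_sqmod_monom (x : cvecs R n) :
  (\sum_I sqmod (monom x I))%:C%C = \prod_k sqnorm k x.
Proof.
rewrite rmorph_sum /sqnorm (prod_sum_idx (fun k j => `|x k j ord0| ^+ 2)).
by apply: eq_bigr => I _; rewrite /= sqmodE normr_prod prodrXl.
Qed.

End GramPenalty.

(** * From nonnegative coefficients to Hermitian squares *)

Section HermitianSquares.
Variables (R : realType) (m : nat) (n : 'I_m -> nat).
Local Notation C := R[i].
Local Notation T := (idx n).

Definition monomp (I : T) : {mpoly C[nvars n]} :=
  \prod_k 'X_(enum_rank (Tagged (fun k => 'I_(n k)) (I k))).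

Lemma monompE (x : cvecs R n) I : (monomp I).@[assign x] = monom x I.
Proof.
rewrite /monomp rmorph_prod; apply: eq_bigr => k _.
by rewrite /= mevalXU /assign enum_rankK.
Qed.

Definition letterp (a : letter n) : {mpoly C[nvars n]} :=
  monomp a.1.1 + 'i%C ^+ a.2 *: monomp a.1.2.

Lemma letterpE (x : cvecs R n) a :
  `|(letterp a).@[assign x]| ^+ 2 = (energy (monom x) a)%:C%C.
Proof. by rewrite /letterp mevalD mevalZ !monompE sqmodE. Qed.

(** A product of energies is the squared modulus of the product of the letter polynomials, and a
    nonnegative coefficient is absorbed as a square root. *)
Lemma HSOS_weval (M : nat) (b : {ffun 'I_M -> letter n} -> R) (t : R)
    (f : cvecs R n -> C) :
  0 <= t -> (forall W, 0 <= b W) ->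
  (forall x, f x = (t * weval b (energy (monom x)))%:C%C) -> HSOS f.
Proof.
move=> t0 b0 fE.
exists [seq (Num.sqrt (t * b W))%:C%C *: \prod_q letterp (W q)
  | W <- index_enum {ffun 'I_M -> letter n}] => x.
rewrite fE big_map /weval mulr_sumr rmorph_sum; apply: eq_bigr => W _ /=.
rewrite mevalZ normrM exprMn rmorph_prod /= normr_prod -prodrXl.
under [in RHS]eq_bigr do rewrite letterpE.
rewrite normc_def /= expr0n addr0 sqrtr_sqr -rmorph_prod -rmorphXn -rmorphM /=.
by rewrite real_normK ?num_real // sqr_sqrtr ?mulr_ge0 // mulrA.
Qed.

Lemma Heval_eq0 (H : tensor R n) (x : cvecs R n) :
  (forall I, monom x I = 0) -> Heval H x = 0.
Proof.
move=> x0; rewrite /Heval big1 // => I _.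
by rewrite big1 // => J _; rewrite (x0 J) mulr0.
Qed.

Lemma monom_eq0 (x : cvecs R n) k I : x k = 0 -> monom x I = 0.
Proof. by move=> xk; rewrite /monom (bigD1 k) //= xk mxE mul0r. Qed.

(** The linear form [f] of the overview. The matrix enters transposed because [Heval] conjugates the
    first index. *)
Definition Hgram (H : tensor R n) (p : letter n -> R) : C :=
  \sum_I \sum_J H I J * gram p J I.

Lemma Hgram_rank_one H p (r : C) x :
  (forall I J, gram p I J = r * monom x I * (monom x J)^*) ->
  Hgram H p = r * Heval H x.
Proof.
move=> pE; rewrite /Hgram /Heval mulr_sumr; apply: eq_bigr => I _.
rewrite mulr_sumr; apply: eq_bigr => J _; rewrite pE; ring.
Qed.

(** A zero of the penalty comes from a product vector with nonzero factors, up to a positive scalar,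
    and there positive definiteness applies. *)
Lemma Hgram_gt0 H p : Cpd H -> penalty p = 0 -> 0 < complex.Re (Hgram H p).
Proof.
move=> [_ Hpd] /penalty_eq0 [h1 h2 h3].
have tr0 : 0 < \sum_I gram p I I.
  (* Were this factor zero, the trace relation would read [0 = 1]. *)
  have N0 : 0 < (8 * #|{: T}|)%:R :> C.
    rewrite ltr0n lt0n; apply: contra_eq_neq h2 => ->.
    by rewrite mul0r eq_sym oner_eq0.
  by rewrite -(pmulr_rgt0 _ N0) h2 ltr01.
have [x [r [r0 x0 pE]]] := product_rank_one h1 tr0 h3.
have : 0 < Hgram H p by rewrite (Hgram_rank_one H pE) mulr_gt0 ?Hpd.
by rewrite ltcE => /andP[].
Qed.

Lemma Cpd_Omega (H : tensor R n) : Cpd H -> exists kk, Omega kk H.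
Proof.
move=> Hpd.
have Pf : wpoly (fun p => complex.Re (Hgram H p)).
  suff [] : cwpoly (Hgram H) by [].
  apply: cwpoly_sum => I; apply: cwpoly_sum => J.
  by apply: cwpolyM; [exact: cwpoly_const | exact: cwpoly_gram].
have [||M [b [M0 b0 bE]]] :=
    wpoly_positivstellensatz Pf (@wpoly_penalty R m n).
- by move=> p _; apply: penalty_ge0.
- by move=> p _; apply: Hgram_gt0.
(* The [M]-th power of the total energy [s] multiplies the linear form at [y / s], which is
   [s^-1 * Heval H x]; one factor cancels, hence [M.-1]. *)
exists (fun=> M.-1); split; first by case: Hpd.
have [N NE] : exists N : R, N = (8 * #|{: T}|)%:R by eexists.
(* This [t] removes the constant [N ^ M.-1] left over from [s = N * S]. *)
apply: (HSOS_weval (M := M) (b := b) (t := N^-1 ^+ M.-1)) => //.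
  by rewrite exprn_ge0 // invr_ge0 NE ler0n.
move=> x; set y := energy (monom x).
have y0 a : 0 <= y a by apply: sqmod_ge0.
rewrite prodrXl -sum_sqmod_monom; set S := \sum_I _.
have sE : \sum_a y a = N * S by rewrite NE; apply: sum_energy.
have : 0 <= \sum_a y a by apply: sumr_ge0.
rewrite le_eqVlt => /predU1P[/esym s0|s0].
  (* Zero total energy makes all monomials vanish; on the side of the squares [M > 0] provides a
     vanishing factor. *)
  have {}y0 a : y a = 0 by apply: (psumr_eq0P _ s0).
  rewrite Heval_eq0 ?mulr0 => [|I].
    rewrite /weval big1 ?mulr0 // => W _.
    by rewrite (bigD1 (Ordinal M0)) //= y0 mul0r mulr0.
  have /eqP := y0 (I, I, ord0); rewrite sqmod_eq0 /= expr0 mul1r.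
  by rewrite -mulr2n mulrn_eq0 /= => /eqP.
set s := \sum_a y a in s0 sE bE.
have sn0 : s != 0 by rewrite gt_eqF.
have [N0 S0] : N != 0 /\ S != 0.
  by move: sn0; rewrite sE mulf_eq0 negb_or => /andP.
pose p a := s^-1 * y a.
have pE I J : gram p I J = s^-1%:C%C * monom x I * (monom x J)^*.
  by rewrite gramZ gram_energy mulrA.
have p0 : penalty p = 0.
  apply/penalty_eq0; split=> [I J||k I J K L].
  - rewrite !pE !rmorphM /= conjCK [RHS]mulrAC; congr (_ * _ * _).
    by apply/eqP; rewrite eq_complex /= oppr0 !eqxx.
  - have -> : \sum_I gram p I I = (s^-1 * S)%:C%C.
      rewrite rmorphM rmorph_sum mulr_sumr; apply: eq_bigr => I _ /=.
      by rewrite pE sqmodE normCK mulrA.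
    rewrite -(rmorph_nat (real_complex R)) -rmorphM /= sE -NE.
    have -> : N * ((N * S)^-1 * S) = 1 by field; rewrite S0 N0.
    by [].
  - rewrite !pE.
    transitivity (s^-1%:C%C ^+ 2 * (monom x I * monom x K) *
                  ((monom x J)^* * (monom x L)^*)); first by ring.
    by rewrite (monom_swap k); ring.
have x0 k : x k != 0.
  apply: contra_neq S0 => xk; rewrite /S big1 // => I _.
  by apply/eqP; rewrite sqmod_eq0 (monom_eq0 _ xk).
(* Positivity in the order on complex numbers includes a zero imaginary part. *)
have Hreal : Heval H x = (complex.Re (Heval H x))%:C%C.
  have := (Hpd.2 x x0); rewrite ltcE /= => /andP[/eqP e _].
  by case: (Heval H x) e => u v /= ->.
rewrite (bE y s0 p0) -/p (Hgram_rank_one H pE) ReM /= mul0r subr0.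
rewrite Hreal -rmorphXn -rmorphM /=; congr _%:C%C.
rewrite -[in s ^+ M](prednK M0) exprS sE exprMn exprVn.
have NM0 : N ^+ M.-1 != 0 by rewrite expf_neq0.
by field; rewrite NM0 N0 S0.
Qed.

(** * The inclusions between the cones *)

Lemma sqnorm_gt0 k (x : cvecs R n) : x k != 0 -> 0 < sqnorm k x.
Proof.
move=> x0; have [j xj] : exists j, x k j ord0 != 0.
  apply/existsP; apply: contraR x0 => /existsPn xj; apply/eqP/matrixP => j j'.
  by rewrite ord1 mxE; apply/eqP; have := xj j; rewrite negbK.
rewrite /sqnorm (bigD1 j) //= ltr_pwDl ?exprn_gt0 ?normr_gt0 //.
by apply: sumr_ge0 => i _; rewrite exprn_ge0.
Qed.

Lemma sum_delta_monom (t : R) (x : cvecs R n) :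
  Heval (fun I J => (t *+ (I == J))%:C%C) x = t%:C%C * \prod_k sqnorm k x.
Proof.
rewrite -sum_sqmod_monom rmorph_sum mulr_sumr; apply: eq_bigr => I _.
rewrite (bigD1 I) //= eqxx big1 ?addr0 => [|J JI].
  by rewrite sqmodE normCK mulrAC -mulrA.
by rewrite eq_sym (negPf JI) mulr0n !mul0r.
Qed.

(* Perturb [H] by a multiple of the tensor of [\prod_k |x_k|^2]. *)
Lemma int_Cpsd_Cpd (H : tensor R n) : int_Cpsd H -> Cpd H.
Proof.
move=> [Hh [e [e0 He]]]; split=> // x x0.
(* The perturbation has squared length [#|T| * t ^ 2], which this [t] keeps below [e ^ 2]. *)
pose t : R := e / #|{: T}|.+1%:R.
have t0 : 0 < t by rewrite divr_gt0 ?ltr0n.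
pose D : tensor R n := fun I J => (t *+ (I == J))%:C%C.
have [_ /(_ x)] : Cpsd (fun I J => H I J - D I J).
  apply: He => [I J|].
    rewrite rmorphB /= -Hh; congr (_ - _).
    by rewrite /D eq_sym /conjc /= oppr0.
  rewrite /dist2 (eq_bigr (fun _ => (t ^+ 2)%:C%C)) => [|I _]; last first.
    rewrite (bigD1 I) //= big1 ?addr0 => [|J JI]; rewrite opprB addrC subrK /D.
      by rewrite eqxx normc_def /= expr0n addr0 sqrtr_sqr -rmorphXn /= real_normK ?num_real.
    by rewrite eq_sym (negPf JI) normr0 expr0n.
  rewrite sumr_const -rmorphMn ltcR -mulr_natr /t exprMn exprVn -mulrA.
  rewrite -[ltRHS]mulr1 ltr_pM2l ?exprn_gt0 // mulrC ltr_pdivrMr ?exprn_gt0 ?ltr0n //.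
  rewrite mul1r -natrX ltr_nat; apply: (@leq_trans #|{: T}|.+1) => //.
  by rewrite expnS expn1 leq_pmulr.
have -> : Heval (fun I J => H I J - D I J) x = Heval H x - Heval D x.
  rewrite /Heval -sumrB; apply: eq_bigr => I _; rewrite -sumrB.
  by apply: eq_bigr => J _; rewrite !mulrBl.
rewrite subr_ge0 sum_delta_monom; apply: lt_le_trans.
by rewrite mulr_gt0 ?ltcR // prodr_gt0 // => k _; apply: sqnorm_gt0.
Qed.

(** If some [x k] is zero, the form vanishes; otherwise the multiplier is positive and can be
    cancelled. *)
Lemma Omega_Cpsd kk (H : tensor R n) : Omega kk H -> Cpsd H.
Proof.
move=> [Hh [s sE]]; split=> // x.
have [/existsP[k /eqP xk]|/existsPn x0] := boolP [exists k, x k == 0].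
  by rewrite Heval_eq0 // => I; apply: monom_eq0 xk.
have P0 : 0 < \prod_k sqnorm k x ^+ kk k.
  apply: prodr_gt0 => k _; exact/exprn_gt0/sqnorm_gt0.
rewrite -(pmulr_rge0 _ P0) sE; apply: sumr_ge0 => p _; exact: exprn_ge0.
Qed.

End HermitianSquares.

Theorem theorem5p10 (R : realType) (m : nat) (n : 'I_m -> nat) :
  (forall H : tensor R n, Cpd H -> exists kk : 'I_m -> nat, Omega kk H) /\
  (forall H : tensor R n, int_Cpsd H -> exists kk : 'I_m -> nat, Omega kk H) /\
  (forall H : tensor R n, (exists kk : 'I_m -> nat, Omega kk H) -> Cpsd H).
Proof.
split; first exact: Cpd_Omega.
split=> [H intH|H [kk]]; last exact: Omega_Cpsd.
exact/Cpd_Omega/int_Cpsd_Cpd.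
Qed.
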